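(* Let $x>0$. Then $$\dim_{\mathrm H}\bigl(\Lambda_{\mathrm{not}}(x)\bigr)=\frac{\log 2}{\log 3}.$$
   Context: For $\lambda>0$, $E_\lambda=\left\{\frac{\lambda}{2}\sum_{i=1}^\infty d_i/3^i : d_i\in\{0,2\}\right\}$ (the self-similar set of the maps $t\mapsto t/3$ and $t\mapsto (t+\lambda)/3$). For $x>0$, $\Lambda(x)=\{\lambda>0 : x\in E_\lambda\}$. Let $\Omega=\{0,2\}^{\mathbb N}$. For $\lambda\in\Lambda(x)$, $\Phi_x(\lambda)$ denotes the (unique) sequence $(d_i)\in\Omega$ with $x=\frac{\lambda}{2}\sum_{i=1}^\infty d_i/3^i$. For $(d_n)\in\Omega$ and $i\in\{0,2\}$ put $$\underline{freq}_i((d_n))=\liminf_{n\to\infty}\frac{\#\{1\le k\le n: d_k=i\}}{n},\qquad \overline{freq}_i((d_n))=\limsup_{n\to\infty}\frac{\#\{1\le k\le n: d_k=i\}}{n}.$$ Define $\Lambda_{\mathrm{not}}(x)=\{\lambda\in\Lambda(x): \underline{freq}_i\,\Phi_x(\lambda)\ne\overline{freq}_i\,\Phi_x(\lambda)\text{ for } i\in\{0,2\}\}$. $\dim_{\mathrm H}$ denotes Hausdorff dimension. *)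

(* Defs.v *)
From HB Require Import structures.
From mathcomp Require Import all_boot all_order all_algebra.
From mathcomp Require Import all_classical all_reals all_analysis.

Set Implicit Arguments.
Unset Strict Implicit.
Unset Printing Implicit Defensive.

Import Order.TTheory GRing.Theory Num.Theory.
Import numFieldNormedType.Exports.

Local Open Scope classical_set_scope.
Local Open Scope ring_scope.

Section HausdorffDimension.
Context {R : realType}.
Implicit Types (s delta : R) (A U : set R).

(* Equal to -oo on the empty set, which [diam_pow] treats separately. *)
Definition diam U : \bar R :=
  ereal_sup [set `|y - z|%:E | y in U & z in U].

(* |U|^s with the convention that the empty set contributes 0 for every s,
   including s = 0, whereas |{y}|^0 = 1. *)
Definition diam_pow s U : \bar R :=
  if `[< U = set0 >] then 0%E else (diam U `^ s)%E.

Definition delta_cover delta A (U : nat -> set R) : Prop :=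
  A `<=` \bigcup_k U k /\ forall k, (diam (U k) <= delta%:E)%E.

Definition hausdorff_premeasure s delta A : \bar R :=
  ereal_inf [set (\sum_(0 <= k <oo) diam_pow s (U k))%E
            | U in [set U : nat -> set R | delta_cover delta A U]].

Definition hausdorff_measure s A : \bar R :=
  ereal_sup [set hausdorff_premeasure s delta A
            | delta in [set delta : R | 0 < delta]].

Definition hausdorff_dim A : \bar R :=
  ereal_inf [set s%:E
            | s in [set s : R | 0 <= s /\ hausdorff_measure s A = 0%E]].

End HausdorffDimension.

(* Digit sequences are indexed from 0: [d k] is the (k+1)-th digit. *)
Definition Omega : set (nat -> nat) :=
  [set d | forall k, d k = 0%N \/ d k = 2%N].

Section SelfSimilarSets.
Context {R : realType}.
Implicit Types (x lambda : R) (d : nat -> nat) (i : nat).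

Definition ternary_sum d : R :=
  limn (series (fun k => (d k)%:R / 3 ^+ k.+1 : R)).

Definition E lambda : set R :=
  [set lambda / 2 * ternary_sum d | d in Omega].

Definition Lambda x : set R := [set lambda | 0 < lambda /\ E lambda x].

(* Off [Lambda x] this is a default sequence; on [Lambda x] with x > 0 the
   expansion exists and is unique, so the choice made by [get] is forced. *)
Definition Phi x lambda : nat -> nat :=
  get [set d | Omega d /\ x = lambda / 2 * ternary_sum d].

(* Value 0 (as 0 / 0) at n = 0. *)
Definition digit_freq i d (n : nat) : R :=
  #|[pred k : 'I_n | d k == i]|%:R / n%:R.

Definition lower_freq i d : R := limn_inf (digit_freq i d).

Definition upper_freq i d : R := limn_sup (digit_freq i d).

Definition Lambda_not x : set R :=
  [set lambda | Lambda x lambda /\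
    forall i, i \in [:: 0%N; 2%N] ->
      lower_freq i (Phi x lambda) <> upper_freq i (Phi x lambda)].

End SelfSimilarSets.

(* Main.v *)
Require Import Defs.
From mathcomp Require Import all_boot all_order all_algebra.
From mathcomp Require Import all_classical all_reals all_analysis.
From mathcomp Require Import ring lra zify.
Import Order.TTheory GRing.Theory Num.Theory.
Import numFieldNormedType.Exports.
Local Open Scope classical_set_scope.
Set Implicit Arguments.
Unset Strict Implicit.
Unset Printing Implicit Defensive.
Local Open Scope ring_scope.

(* Write T d for the ternary sum of d. The map d |-> 2x / T d sends the Cantor
   set onto Lambda x, and it is bi-Lipschitz away from T d = 0, so the upper
   bound comes from covering by cylinders.

   For the lower bound let s < ln 2 / ln 3. Prescribe the digits at the multiples
   of p + 1 and let the others be free bits: for p large the resulting sets still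
   have dimension above s. Two prescriptions are used, one with constant digit 2
   and one switching between 2 and 0 on dyadic blocks of positions. For the same
   free bits the counts of 2 in the two sequences differ by a number without a
   density, so the two sequences cannot both have digit frequencies. A cover of
   Lambda_not x with small s-sum therefore induces, through both prescriptions
   together, a cover of the space of free bits by cylinders of total
   coin-tossing mass < 1, which is impossible. No law of large numbers is
   needed. *)

(** * Ternary sums: cylinders, gaps, and the description of [Lambda x] *)

Section TernarySum.
Context {R : realType}.
Implicit Types (d e : nat -> nat) (n k : nat).

Lemma digit_le2 d k : Omega d -> (d k <= 2)%N.
Proof. by move=> /(_ k)[] ->. Qed.

Lemma Omega_shift d : Omega d -> Omega (fun k => d k.+1).
Proof. by move=> Od k; exact: Od. Qed.

Let term d k : R := (d k)%:R / 3 ^+ k.+1.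

Lemma ternary_term_ge0 d k : 0 <= term d k.
Proof. by rewrite divr_ge0// exprn_ge0. Qed.

Lemma series_ternary_le d n : Omega d -> series (term d) n <= 1 - 3 ^- n.
Proof.
move=> Od; elim: n => [|n IH].
  by rewrite /series/= big_geq// expr0 invr1 subrr.
rewrite /series/= big_nat_recr//=.
apply: (le_trans (lerD IH (_ : _ <= 2 / 3 ^+ n.+1))).
  by rewrite /term ler_pM2r ?invr_gt0 ?exprn_gt0// ler_nat digit_le2.
rewrite exprS invfM; set y := _ ^-1 in IH *; lra.
Qed.

Lemma cvg_ternary d : Omega d -> cvgn (series (term d)).
Proof.
move=> Od; apply: nondecreasing_is_cvgn.
  by apply: nondecreasing_series => k _ _; exact: ternary_term_ge0.
exists 1 => _ [n _ <-].
by rewrite (le_trans (series_ternary_le n Od))// gerBl invr_ge0 exprn_ge0.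
Qed.

Lemma ternary_sum_ge0 d : Omega d -> 0 <= ternary_sum d :> R.
Proof.
move=> Od; apply: limr_ge; first exact: cvg_ternary.
by apply: nearW => n; rewrite /series/= sumr_ge0// => k _; exact: ternary_term_ge0.
Qed.

Lemma ternary_sum_le1 d : Omega d -> ternary_sum d <= 1 :> R.
Proof.
move=> Od; apply: limr_le; first exact: cvg_ternary.
apply: nearW => n.
by rewrite (le_trans (series_ternary_le n Od))// gerBl invr_ge0 exprn_ge0.
Qed.

Lemma ternary_sumS d : Omega d ->
  ternary_sum d = ((d 0%N)%:R + ternary_sum (fun k => d k.+1)) / 3 :> R.
Proof.
move=> Od; apply/cvg_lim => //; rewrite -cvg_shiftS /=.
have -> : (fun n => series (term d) n.+1) =
    (fun n => ((d 0%N)%:R + series (term (fun k => d k.+1)) n) / 3).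
  apply/funext => n; rewrite /series/= big_nat_recl//= mulrDl mulr_suml.
  congr (_ + _); apply: eq_bigr => k _.
  by rewrite /term [in LHS]exprS invfM -mulrA [3^-1 * _]mulrC.
apply: cvgMl; apply: cvgD; first exact: cvg_cst.
exact: cvg_ternary (Omega_shift Od).
Qed.

Lemma ternary_sum_cylinder d e n : Omega d -> Omega e ->
  (forall k, (k < n)%N -> d k = e k) ->
  `|ternary_sum d - ternary_sum e| <= 3 ^- n :> R.
Proof.
elim: n d e => [|n IH] d e Od Oe de.
  rewrite expr0 invr1 ler_norml.
  have := ternary_sum_ge0 Od; have := ternary_sum_ge0 Oe.
  have := ternary_sum_le1 Od; have := ternary_sum_le1 Oe.
  by move=> *; apply/andP; split; lra.
rewrite (ternary_sumS Od) (ternary_sumS Oe) de// -mulrBl opprD addrACA subrr add0r.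
rewrite exprSr invfM normrM [`|3^-1|]ger0_norm// ler_pM2r//.
by apply: IH => //; [exact: Omega_shift..|move=> k kn; exact: de].
Qed.

(** A first digit 0 puts the sum in [0, 1/3] and a first digit 2 puts it in [2/3, 1]. *)
Lemma ternary_sum_head d e : Omega d -> Omega e ->
  `|ternary_sum d - ternary_sum e| < 3^-1 :> R -> d 0%N = e 0%N.
Proof.
move=> Od Oe; rewrite (ternary_sumS Od) (ternary_sumS Oe) ltr_norml => /andP[].
have := ternary_sum_ge0 (Omega_shift Od); have := ternary_sum_ge0 (Omega_shift Oe).
have := ternary_sum_le1 (Omega_shift Od); have := ternary_sum_le1 (Omega_shift Oe).
by case: (Od 0%N) => ->; case: (Oe 0%N) => -> // *; exfalso; lra.
Qed.

Lemma ternary_sum_gap d e n : Omega d -> Omega e ->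
  `|ternary_sum d - ternary_sum e| < 3 ^- n :> R ->
  forall k, (k < n)%N -> d k = e k.
Proof.
elim: n d e => [|n IH] d e Od Oe de //.
have d0 : d 0%N = e 0%N.
  apply: ternary_sum_head => //; apply: (lt_le_trans de).
  by rewrite exprS invfM ler_piMr// invf_le1 ?exprn_gt0// exprn_ege1// ler1n.
move=> [|k] kn //.
apply: (IH (fun k => d k.+1) (fun k => e k.+1)) => //; [exact: Omega_shift..|].
move: de; rewrite (ternary_sumS Od) (ternary_sumS Oe) d0 -mulrBl.
rewrite opprD addrACA subrr add0r.
by rewrite exprSr invfM normrM [`|3^-1|]ger0_norm// ltr_pM2r.
Qed.

Lemma ternary_sum_inj d e : Omega d -> Omega e ->
  ternary_sum d = ternary_sum e :> R -> d = e.
Proof.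
move=> Od Oe de; apply/funext => k.
apply: (@ternary_sum_gap d e k.+1) => //.
by rewrite de subrr normr0 invr_gt0 exprn_gt0.
Qed.

(** Injectivity of the ternary sum leaves [get] only one sequence to choose. *)
Lemma Phi_ternary_sum (x : R) d : 0 < x -> Omega d -> 0 < ternary_sum d :> R ->
  Phi x (2 * x / ternary_sum d) = d.
Proof.
move=> x0 Od d0; rewrite /Phi.
have xE : x = 2 * x / ternary_sum d / 2 * ternary_sum d.
  by field; rewrite lt0r_neq0.
have [Oe] := @getPex _ [set e | Omega e /\ x = 2 * x / ternary_sum d / 2 * ternary_sum e]
  (ex_intro _ d (conj Od xE)).
rewrite {1}xE => /mulfI h; apply: ternary_sum_inj => //; apply/esym/h.
by rewrite lt0r_neq0// !divr_gt0// mulr_gt0.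
Qed.

Lemma LambdaP (x lambda : R) : 0 < x -> Lambda x lambda <->
  exists d, [/\ Omega d, 0 < ternary_sum d :> R & lambda = 2 * x / ternary_sum d].
Proof.
move=> x0; split=> [[l0 [d Od dx]]|[d [Od d0 ->]]].
  have d0 : 0 < ternary_sum d :> R.
    rewrite lt_neqAle ternary_sum_ge0// andbT; apply/eqP => d0.
    by move: dx x0; rewrite -d0 mulr0 => <-; rewrite ltxx.
  by exists d; split => //; rewrite -dx; field; rewrite lt0r_neq0.
split; first by rewrite divr_gt0// mulr_gt0.
by exists d => //; field; rewrite lt0r_neq0.
Qed.

End TernarySum.

(** * Digit frequencies and their convergence *)

Section DigitFrequency.
Context {R : realType}.
Implicit Types (d : nat -> nat) (n i : nat).

Lemma digit_freqE i d n :
  digit_freq i d n = (\sum_(0 <= k < n) (d k == i))%N%:R / n%:R :> R.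
Proof.
by rewrite /digit_freq -sum1_card big_mkcond/= big_mkord; congr (_%:R / _).
Qed.

Lemma digit_freq_ge0 i d n : 0 <= digit_freq i d n :> R.
Proof. by rewrite divr_ge0. Qed.

Lemma digit_freq_le1 i d n : digit_freq i d n <= 1 :> R.
Proof.
case: n => [|n]; first by rewrite /digit_freq invr0 mulr0.
by rewrite ler_pdivrMr// mul1r ler_nat (leq_trans (max_card _))// card_ord.
Qed.

Lemma digit_freq_compl d n : Omega d -> (0 < n)%N ->
  digit_freq 0 d n = 1 - digit_freq 2 d n :> R.
Proof.
move=> Od n0; rewrite !digit_freqE; apply/eqP.
rewrite eq_sym subr_eq -mulrDl -natrD -big_split/=.
rewrite (eq_bigr (fun=> 1%N)); last by move=> k _; case: (Od k) => ->.
by rewrite sum_nat_const_nat subn0 muln1 divff// pnatr_eq0 -lt0n.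
Qed.

Lemma cvg_digit_freq i d :
  lower_freq i d = upper_freq i d :> R -> cvgn (digit_freq i d : nat -> R).
Proof.
set u := (digit_freq i d : nat -> R) => ul.
have uub : has_ubound (range u).
  by exists 1 => _ [n _ <-]; exact: digit_freq_le1.
have ulb : has_lbound (range u).
  by exists 0 => _ [n _ <-]; exact: digit_freq_ge0.
have cs := cvg_sups_inf uub ulb; have ci := cvg_infs_sup uub ulb.
apply/cvg_ex; exists (upper_freq i d).
apply: (@squeeze_cvgr _ _ _ _ (infs u) (sups u)).
- apply: nearW => n; apply/andP; split.
    apply: ge_inf; last by exists n => /=.
    by case: ulb => y yl; exists y => _ [k _ <-]; apply: yl; exists k.
  apply: ub_le_sup; last by exists n => /=.
  by case: uub => y yl; exists y => _ [k _ <-]; apply: yl; exists k.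
- by rewrite -ul; apply/cvg_ex; exists (sup (range (infs u))).
- by apply/cvg_ex; exists (inf (range (sups u))).
Qed.

(** The two digit frequencies add up to 1 for n > 0, so refuting convergence for the digit 2 settles
    both digits in [Lambda_not]. *)
Lemma cvg_digit_freq2 i d : Omega d -> i \in [:: 0%N; 2%N] ->
  lower_freq i d = upper_freq i d :> R -> cvgn (digit_freq 2 d : nat -> R).
Proof.
move=> Od; rewrite !inE => /orP[]/eqP-> /cvg_digit_freq// c.
apply/cvg_ex; exists (1 - limn (digit_freq 0 d)).
have : (fun n => 1 - digit_freq 0 d n : R) n @[n --> \oo] -->
    1 - limn (digit_freq 0 d : nat -> R).
  by apply: cvgB; [exact: cvg_cst | exact: c].
apply: cvg_trans; apply: near_eq_cvg.
near=> n; rewrite /= digit_freq_compl//; first by rewrite opprB addrC subrK.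
by near: n; exact: nbhs_infty_gt.
Unshelve. all: by end_near. Qed.

End DigitFrequency.

(** * Sequences with prescribed digits at the multiples of p + 1 *)

Section SparselyForcedCode.
Local Open Scope nat_scope.
Implicit Types (p k m n j : nat) (g w : nat -> bool).

(* The digits at the multiples of [p.+1] are prescribed by [g], the other ones
   list the bits of [w]. *)
Definition sparse_code p g w k : nat :=
  if k %% p.+1 == 0 then (g (k %/ p.+1)).*2 else (w (k - k %/ p.+1).-1).*2.

Lemma Omega_sparse_code p g w : Omega (sparse_code p g w).
Proof.
by move=> k; rewrite /sparse_code; case: ifP => _; [case: (g _)|case: (w _)]; auto.
Qed.

(** The bit [w j] is preceded by j free bits and by j %/ p + 1 prescribed digits, one at the head of
    each block begun so far. *)
Lemma code_bit p g w j : 0 < p -> sparse_code p g w (j + j %/ p).+1 = (w j).*2.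
Proof.
move=> p0; have jp := ltn_pmod j p0.
have kE : (j + j %/ p).+1 = (j %/ p) * p.+1 + (j %% p).+1.
  by have := divn_eq j p; rewrite mulnS; lia.
have kd : (j + j %/ p).+1 %/ p.+1 = j %/ p.
  by rewrite kE divnMDl// (@divn_small (j %% p).+1) ?addn0.
rewrite /sparse_code kd kE modnMDl modn_small//= -kE.
by congr (w _).*2; lia.
Qed.

Lemma code_agree p g w w' q : 0 < p ->
  (forall k, k < q * p.+1 -> sparse_code p g w k = sparse_code p g w' k) ->
  forall j, j < q * p -> w j = w' j.
Proof.
move=> p0 ww' j jq; have := ww' (j + j %/ p).+1; rewrite !code_bit//.
have jpq : j %/ p < q by rewrite ltn_divLR.
have -> : (j + j %/ p).+1 < q * p.+1 by lia.
by case: (w j); case: (w' j) => // /(_ isT).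
Qed.

(** Block by block: the two codes can differ only at the head of a block, and do so where [g] is
    false. *)
Lemma count_code_forced p g w m :
  \sum_(0 <= k < m * p.+1) (sparse_code p xpredT w k == 2) =
  \sum_(0 <= k < m * p.+1) (sparse_code p g w k == 2) + \sum_(0 <= i < m) ~~ g i.
Proof.
rewrite !big_nat_mul -big_split/=; apply: eq_bigr => i _.
have blockE h : \sum_(i * p.+1 <= k < i.+1 * p.+1) (sparse_code p h w k == 2) =
    h i + \sum_((i * p.+1).+1 <= k < i.+1 * p.+1) (sparse_code p xpredT w k == 2).
  rewrite big_ltn; last by rewrite ltn_mul2r/=.
  rewrite {1}/sparse_code modnMl mulnK//=; congr (_ + _); first by case: (h i).
  rewrite big_nat_cond [in RHS]big_nat_cond; apply: eq_bigr => k /andP[/andP[ik ki] _].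
  rewrite /sparse_code; case: ifP => // /dvdnP[c kE]; exfalso.
  by move: ik ki; rewrite kE ltn_mul2r/= => ic; rewrite ltn_mul2r/=; lia.
by rewrite !blockE; case: (g i) => /=; lia.
Qed.

(** For m > 0, true on the dyadic blocks [2^j, 2^(j+1)) with j even. Since [trunc_log 2 0] is 0, it
    is true at 0 as well, which makes the first digit of the code 2 and its ternary sum positive. *)
Definition dyadic_alternating m := ~~ odd (trunc_log 2 m).

Definition dyadic_count m := \sum_(0 <= i < m) ~~ dyadic_alternating i.

Lemma dyadic_count_double j :
  dyadic_count (2 ^ j.+1) = dyadic_count (2 ^ j) + odd j * 2 ^ j.
Proof.
rewrite /dyadic_count (big_cat_nat (n := 2 ^ j))//=; last by rewrite leq_exp2l.
congr (_ + _).
rewrite big_nat_cond (eq_bigr (fun=> odd j : nat)); last first.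
  by move=> i /andP[ij _]; rewrite /dyadic_alternating (trunc_log_eq (n := j))// negbK.
by rewrite -big_nat_cond sum_nat_const_nat expnS mul2n -addnn addnK mulnC.
Qed.

End SparselyForcedCode.

(** * Two prescriptions cannot both yield a digit frequency *)

Section FrequencyDichotomy.
Context {R : realType}.
Implicit Types (p : nat) (w : nat -> bool).

(* The average of [~~ dyadic_alternating] over [0, 2^j) is halved from [j] to
   [j + 1] for even [j], and halved then increased by 1/2 for odd [j]. *)
Lemma dyadic_count_ncvg :
  ~ cvgn (fun j => (dyadic_count (2 ^ j))%:R / 2 ^+ j : R).
Proof.
set u := fun j => _; move=> cu.
have cuS : u n.+1 @[n --> \oo] --> limn u by rewrite cvg_shiftS.
have uS j : u j.+1 - 2^-1 * u j = (odd j)%:R / 2.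
  rewrite /u dyadic_count_double natrD natrM natrX exprS.
  by field; rewrite expf_neq0.
have cv : ((odd j)%:R / 2 : R) @[j --> \oo] --> limn u - 2^-1 * limn u.
  under eq_cvg do rewrite -uS.
  by apply: cvgB => //; apply: cvgMr; exact: cu.
have cvS : ((odd j.+1)%:R / 2 : R) @[j --> \oo] --> limn u - 2^-1 * limn u.
  by rewrite (cvg_shiftS (fun j => (odd j)%:R / 2 : R)); exact: cv.
(* Consecutive values of [odd j] / 2 always differ by 1/2, while a limit would send their difference
   to 0. *)
have := cvg_norm (cvgB cvS cv); rewrite subrr normr0.
have -> : (fun j => `|(odd j.+1)%:R / 2 - (odd j)%:R / 2 : R|) = cst 2^-1.
  apply/funext => j /=; case: (odd j) => /=;
    by rewrite ?mul0r ?mul1r ?subr0 ?sub0r ?normrN ger0_norm.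
move=> /(_ _ _) c0; have h : 2^-1 = 0 :> R.
  by rewrite -(cvg_lim (@norm_hausdorff _ _) c0) lim_cst.
by have : 0 < 2^-1 :> R by []; rewrite h ltxx.
Qed.

Lemma digit_freq_dichotomy p w :
  cvgn (digit_freq 2 (sparse_code p xpredT w) : nat -> R) ->
  ~ cvgn (digit_freq 2 (sparse_code p dyadic_alternating w) : nat -> R).
Proof.
set u := (X in cvgn X -> _); set v := (X in _ -> ~ cvgn X) => cu cv.
apply: dyadic_count_ncvg.
have c2 : (fun j => 2 ^ j * p.+1)%N @ \oo --> \oo.
  apply/cvgnyPge => A; near=> j.
  rewrite (@leq_trans (2 ^ j))//; last by rewrite leq_pmulr.
  rewrite (@leq_trans j)//; last exact/ltnW/ltn_expl.
  by near: j; exact: nbhs_infty_ge.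
(* Along the lengths 2^j (p + 1) the counts of 2 differ by [dyadic_count (2 ^ j)], whatever the free
   bits are. *)
have avgE : (fun j => (dyadic_count (2 ^ j))%:R / 2 ^+ j) =
    (fun j => p.+1%:R * (u (2 ^ j * p.+1)%N - v (2 ^ j * p.+1)%N)).
  apply/funext => j.
  rewrite /u /v !digit_freqE.
  rewrite (count_code_forced p dyadic_alternating w) -/(dyadic_count _).
  rewrite -mulrBl natrD addrAC subrr add0r natrM natrX.
  by field; rewrite expf_neq0//= addrC natr1 pnatr_eq0.
rewrite avgE; apply/cvg_ex; exists (p.+1%:R * (limn u - limn v)).
by apply: cvgMr; apply: cvgB; apply: cvg_comp c2 _; [exact: cu|exact: cv].
Unshelve. all: by end_near. Qed.

End FrequencyDichotomy.

(** * Cylinders of total mass below 1 miss some binary sequence *)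

Section CylinderCover.
Context {R : realType}.
Implicit Types (u w : seq bool) (U : nat -> seq (seq bool)).

(* The coin-tossing measure of the set of the binary sequences that extend
   both [u] and [w]. *)
Fixpoint common_mass u w : R :=
  match u, w with
  | [::], _ => 2 ^- size w
  | _ :: _, [::] => 2 ^- size u
  | a :: u', b :: w' => if a == b then common_mass u' w' / 2 else 0
  end.

Lemma common_mass_ge0 u w : 0 <= common_mass u w.
Proof.
elim: u w => [|a u IH] [|b w] //=; rewrite ?invr_ge0 ?exprn_ge0//.
by case: ifP => // _; rewrite divr_ge0.
Qed.

Lemma common_mass0 u : common_mass u [::] = 2 ^- size u.
Proof. by case: u. Qed.

Lemma common_massxx u : common_mass u u = 2 ^- size u.
Proof. by elim: u => //= a u ->; rewrite eqxx exprSr invfM. Qed.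

Lemma common_mass_split u w : common_mass u w =
  common_mass u (rcons w false) + common_mass u (rcons w true).
Proof.
have half n : 2 ^- n = 2 ^- n.+1 + 2 ^- n.+1 :> R.
  by rewrite exprSr invfM -splitr.
elim: u w => [|a u IH] [|b w]; rewrite /= ?size_rcons ?common_mass0 -?half//.
  by case: a; rewrite /= ?addr0 ?add0r exprSr invfM.
by case: ifP => _; rewrite ?addr0// -mulrDl -IH.
Qed.

(** The bits of [omega] are chosen one at a time, so that the cylinders never fill the cylinder of
    the current prefix: [F w], the mass they have in common with [w], stays below 2^-(size w). *)
Lemma cylinder_cover U :
  (\sum_(0 <= k <oo) (\sum_(u <- U k) 2 ^- size u)%:E < (1 : R)%:E)%E ->
  exists omega : nat -> bool,
    forall k u, u \in U k -> mkseq omega (size u) <> u.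
Proof.
move=> U1; pose F w := (\sum_(0 <= k <oo) (\sum_(u <- U k) common_mass u w)%:E)%E.
have mass_ge0 w k : (0 <= (\sum_(u <- U k) common_mass u w)%:E)%E.
  by rewrite lee_fin sumr_ge0// => u _; exact: common_mass_ge0.
have F_split w : F w = (F (rcons w false) + F (rcons w true))%E.
  rewrite /F -nneseriesD//; apply: eq_eseriesr => k _.
  by rewrite -EFinD -big_split/=; under eq_bigr do rewrite common_mass_split.
pose b w := ~~ (F (rcons w false) < (2 ^- (size w).+1)%:E)%E.
(* If both one-bit extensions were full, their masses would add up to at least 2^-(size w). *)
have F_step w : (F w < (2 ^- size w)%:E)%E ->
    (F (rcons w (b w)) < (2 ^- (size w).+1)%:E)%E.
  move=> Fw; rewrite /b; case: (ltP (F (rcons w false))) => [//|Fl].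
  rewrite ltNge; apply/negP => Fr.
  move: Fw; rewrite F_split ltNge => /negP; apply.
  by apply: le_trans (leeD Fl Fr); rewrite -EFinD lee_fin exprSr invfM -splitr.
pose W := fix W n := if n is m.+1 then rcons (W m) (b (W m)) else [::].
pose omega n := b (W n).
have WE n : mkseq omega n = W n by elim: n => //= n IH; rewrite mkseqS IH.
have sW n : size (W n) = n by rewrite -WE size_mkseq.
have FW n : (F (W n) < (2 ^- n)%:E)%E.
  elim: n => [|n IH].
    rewrite expr0 invr1; apply: le_lt_trans U1; apply: lee_nneseries => // k _.
    by rewrite lee_fin; apply: ler_sum => u _; rewrite common_mass0.
  by rewrite -[n in 2 ^- n.+1]sW; apply: F_step; rewrite sW.
exists omega => k u uU; rewrite WE => Wu.
(* A prefix [u] of [omega] taken from the cover would contribute its whole mass to [F u], against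
   [FW]. *)
have := FW (size u); rewrite Wu ltNge => /negP; apply.
apply: (@le_trans _ _ (\sum_(u' <- U k) common_mass u' u)%:E).
  rewrite lee_fin (big_rem u)//= common_massxx lerDl sumr_ge0// => u' _.
  exact: common_mass_ge0.
rewrite /F (@nneseriesD1 _ _ k)//= leeDl// nneseries_ge0// => i _ _; exact: mass_ge0.
Qed.

End CylinderCover.

(** * Hausdorff premeasures: null sets, countable unions, finite covers *)

Section HausdorffNullSets.
Context {R : realType}.
Implicit Types (A U : set R) (s delta c : R).

Lemma diam_ge U y z : U y -> U z -> (`|y - z|%:E <= diam U)%E.
Proof. by move=> Uy Uz; apply: ereal_sup_ubound; exists y => //; exists z. Qed.

Lemma diam_pow_ge0 s U : (0 <= diam_pow s U)%E.
Proof. by rewrite /diam_pow; case: ifP => // _; exact: poweR_ge0. Qed.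

Lemma diam_le c U : (forall y z, U y -> U z -> `|y - z| <= c) ->
  (diam U <= c%:E)%E.
Proof. by move=> Uc; apply: ge_ereal_sup => _ [y Uy [z Uz <-]]; rewrite lee_fin Uc. Qed.

Lemma diam_pow_le s c U : 0 <= s -> 0 <= c ->
  (forall y z, U y -> U z -> `|y - z| <= c) -> (diam_pow s U <= (c `^ s)%:E)%E.
Proof.
move=> s0 c0 Uc; rewrite /diam_pow; case: asboolP => [_|/eqP/set0P[y Uy]].
  by rewrite lee_fin powR_ge0.
have d0 : (0 <= diam U)%E by have := diam_ge Uy Uy; rewrite subrr normr0.
rewrite -poweR_EFin; apply: gt0_ler_poweR => //; last exact: diam_le.
- by rewrite in_itv/= d0 leey.
- by rewrite in_itv/= lee_fin c0 leey.
Qed.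

Lemma premeasure_ge0 s delta A : (0 <= hausdorff_premeasure s delta A)%E.
Proof.
apply: le_ereal_inf_tmp => _ [U _ <-]; apply: nneseries_ge0 => k _ _.
exact: diam_pow_ge0.
Qed.

Lemma hausdorff_measure_eq0 s A : hausdorff_measure s A = 0%E <->
  forall delta, 0 < delta -> hausdorff_premeasure s delta A = 0%E.
Proof.
split=> [H0 delta d0|H0].
  apply/le_anti; rewrite premeasure_ge0 andbT -H0.
  by apply: ereal_sup_ubound; exists delta.
rewrite /hausdorff_measure (_ : [set _ | _ in _] = [set 0%E]) ?ereal_sup1//.
apply/seteqP; split => [_ [delta d0 <-]|_ ->]; first exact: H0.
by exists 1; [exact: ltr01|apply: H0; exact: ltr01].
Qed.

Lemma premeasure_bigcup0 s delta (A : nat -> set R) :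
  (forall m, hausdorff_premeasure s delta (A m) = 0%E) ->
  hausdorff_premeasure s delta (\bigcup_m A m) = 0%E.
Proof.
move=> A0; apply/le_anti; rewrite premeasure_ge0 andbT.
apply/lee_addgt0Pr => e e0; rewrite add0e.
have [G PG] : {G : nat -> nat -> set R & forall m, delta_cover delta (A m) (G m) /\
    (\sum_(0 <= k <oo) diam_pow s (G m k) <= (e / (2 ^ m.+1)%:R)%:E)%E}.
  apply: (@choice _ _ (fun m (V : nat -> set R) => delta_cover delta (A m) V /\
    (\sum_(0 <= k <oo) diam_pow s (V k) <= (e / (2 ^ m.+1)%:R)%:E)%E)) => m.
  have : (hausdorff_premeasure s delta (A m) < (e / (2 ^ m.+1)%:R)%:E)%E.
    by rewrite A0 lte_fin divr_gt0// ltr0n expn_gt0.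
  by move=> /ereal_inf_lt[_ [V AV <-] /ltW]; exists V.
have /card_esym/ppcard_eqP[f] := card_nat2.
pose V k := G (f k).1 (f k).2.
apply: (@le_trans _ _ (\sum_(0 <= k <oo) diam_pow s (V k))%E).
  apply: ereal_inf_lbound; exists V => //; split => [y [m _]|k]; last exact: (PG _).1.2.
  move=> /((PG m).1.1) [j _ Gy]; exists (f^-1%FUN (m, j)) => //=.
  by rewrite /V invK ?inE.
rewrite nneseries_esumT; last by move=> ?; exact: diam_pow_ge0.
rewrite -(@reindex_esum _ _ _ setT setT f (fun i => diam_pow s (G i.1 i.2)))//.
rewrite (_ : [set: nat * nat] = setT `*`` (fun=> setT)); last first.
  by apply/seteqP; split.
rewrite -(@esum_esum _ _ _ setT (fun=> setT) (fun i j => diam_pow s (G i j))); last first.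
  by move=> *; exact: diam_pow_ge0.
rewrite -nneseries_esumT; last by move=> m; apply: esum_ge0 => j _; exact: diam_pow_ge0.
apply: le_trans (_ : \sum_(0 <= m <oo) (0 + (e / (2 ^ m.+1)%:R)%:E) <= _)%E.
  apply: lee_nneseries => m _.
    by move=> _; apply: esum_ge0 => j _; exact: diam_pow_ge0.
  rewrite add0e -nneseries_esumT; first exact: (PG m).2.
  by move=> ?; exact: diam_pow_ge0.
apply: le_trans (epsilon_trick _ _ _) _ => //; first exact: ltW.
by rewrite eseries0 ?add0e.
Qed.

Lemma premeasure_le_finite s delta c A (I : finType) (U : I -> set R) :
  0 <= s -> 0 <= c <= delta -> A `<=` \bigcup_i U i ->
  (forall i y z, U i y -> U i z -> `|y - z| <= c) ->
  (hausdorff_premeasure s delta A <= (#|I|%:R * c `^ s)%:E)%E.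
Proof.
move=> s0 /andP[c0 cd] AU Uc.
(* Padding by the empty set is free even for s = 0, by the convention in [diam_pow]. *)
pose V k := if (insub k : option 'I_#|I|) is Some j then U (enum_val j) else set0 : set R.
have Vc k y z : V k y -> V k z -> `|y - z| <= c.
  by rewrite /V; case: insubP => [j _ _|_]//; exact: Uc.
apply: (@le_trans _ _ (\sum_(0 <= k <oo) diam_pow s (V k))%E).
  apply: ereal_inf_lbound; exists V => //; split => [y /AU[i _ Uy]|k].
    by exists (enum_rank i) => //; rewrite /V valK enum_rankK.
  by apply: le_trans (_ : c%:E <= _)%E; [exact: diam_le (@Vc k)|rewrite lee_fin].
rewrite (nneseries_split 0 #|I|); last by move=> *; exact: diam_pow_ge0.
rewrite add0n [X in (_ + X)%E]eseries0 ?adde0; last first.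
  move=> k kI _; rewrite /V insubF ?ltnNge ?kI// /diam_pow.
  by case: asboolP.
apply: (@le_trans _ _ (\sum_(0 <= k < #|I|) (c `^ s)%:E)%E).
  by apply: lee_sum => k _; apply: diam_pow_le => //; exact: Vc.
by rewrite sumEFin sumr_const_nat subn0 mulr_natl.
Qed.

End HausdorffNullSets.

(** * Upper bound: covers of [Lambda x] by images of cylinders *)

Section UpperBound.
Context {R : realType}.
Implicit Types (x s delta : R).

Lemma ln3_gt0 : 0 < ln 3 :> R.
Proof. by rewrite ln_gt0// ltr1n. Qed.

Lemma powR_exprV (a : R) s n : 0 <= a -> (a ^- n) `^ s = (a `^ s) ^- n.
Proof.
by move=> a0; rewrite -powR_invn// -powRrM mulrC powRrM powR_invn// powR_ge0.
Qed.

Lemma premeasure_le s delta (A A' : set R) : A `<=` A' ->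
  (hausdorff_premeasure s delta A <= hausdorff_premeasure s delta A')%E.
Proof.
move=> AA'; apply: ereal_inf_le_tmp => _ [U [A'U dU] <-]; exists U => //.
by split=> //; apply: subset_trans AA' A'U.
Qed.

Lemma Lambda_dist x a b : 0 < a -> 0 < b ->
  2 * x / a - 2 * x / b = 2 * x / (a * b) * (b - a).
Proof. by move=> a0 b0; field; rewrite !lt0r_neq0. Qed.

(** The assumption on s means 2 < 3^s, so the total cost of the 2^n cylinders is a constant times (2
    / 3^s)^n. *)
Lemma geometric_cover_size x s delta e m : 0 < x -> ln 2 / ln 3 < s ->
  0 < delta -> 0 < e ->
  exists n : nat, let c := 2 * x * 9 ^+ m / 3 ^+ n in
    c <= delta /\ 2 ^+ n * c `^ s <= e.
Proof.
move=> x0 s23 d0 e0; pose K := 2 * x * 9 ^+ m.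
have K0 : 0 < K by rewrite !mulr_gt0// exprn_gt0.
have s3 : 2 < 3 `^ s.
  rewrite -ltr_ln ?posrE ?powR_gt0// ln_powR.
  by rewrite -ltr_pdivrMr// ln3_gt0.
have r0 : 0 < 2 / 3 `^ s by rewrite divr_gt0// powR_gt0.
have r1 : `|2 / 3 `^ s| < 1.
  by rewrite gtr0_norm// ltr_pdivrMr ?mul1r// powR_gt0.
have t1 : `|3^-1 : R| < 1 by rewrite gtr0_norm// invf_lt1// ltr1n.
have h1 := cvgr0_norm_lt _ (cvg_geometric K t1) _ d0.
have h2 := cvgr0_norm_lt _ (cvg_geometric (K `^ s) r1) _ e0.
near \oo => n; exists n => /=; split.
  apply/ltW/(le_lt_trans (ler_norm _)); rewrite -/K -exprVn.
  by near: n; exact: h1.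
have -> : 2 ^+ n * (K / 3 ^+ n) `^ s = K `^ s * (2 / 3 `^ s) ^+ n.
  rewrite powRM ?ltW ?invr_gt0 ?exprn_gt0// powR_exprV//.
  by rewrite exprMn exprVn mulrCA.
apply/ltW/(le_lt_trans (ler_norm _)).
by near: n; exact: h2.
Unshelve. all: by end_near. Qed.

Lemma hausdorff_measure_Lambda x s (A : set R) : 0 < x -> ln 2 / ln 3 < s ->
  A `<=` Lambda x -> hausdorff_measure s A = 0%E.
Proof.
move=> x0 s23 AL; apply/hausdorff_measure_eq0 => delta d0.
have s0 : 0 <= s.
  by apply/ltW/(lt_trans _ s23); rewrite divr_gt0// ln_gt0// ltr1n.
(* On sums at least 3^-m the map t |-> 2x / t has Lipschitz constant at most 2x 9^m, the factor in
   [geometric_cover_size]. *)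
pose P m := [set lambda : R | exists d, [/\ Omega d,
  3 ^- m <= ternary_sum d :> R & lambda = 2 * x / ternary_sum d]].
have AP : A `<=` \bigcup_m P m.
  move=> lambda /AL /(LambdaP _ x0) [d [Od d0' ->]].
  have [m _ /(_ m (leqnn _))] := near_infty_natSinv_expn_lt (PosNum d0').
  move=> /= dm; exists m => //; exists d; split=> //.
  apply: le_trans (ltW dm); rewrite div1r lef_pV2 ?posrE ?exprn_gt0//.
  by rewrite lerXn2r ?nnegrE// ler_nat.
suff P0 m : hausdorff_premeasure s delta (P m) = 0%E.
  apply/le_anti; rewrite premeasure_ge0 andbT -(premeasure_bigcup0 P0).
  exact: premeasure_le.
apply/le_anti; rewrite premeasure_ge0 andbT.
apply/lee_addgt0Pr => e e0; rewrite add0e.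
have [n [/= cd ce]] := geometric_cover_size m x0 s23 d0 e0.
set c := 2 * x * _ / _ in cd ce.
have c0 : 0 <= c by rewrite !mulr_ge0// ?ltW// ?invr_ge0 exprn_ge0.
pose U (t : n.-tuple bool) := [set lambda : R | exists d, [/\ Omega d,
  3 ^- m <= ternary_sum d :> R, lambda = 2 * x / ternary_sum d &
  forall k, (k < n)%N -> d k = (nth false t k).*2]].
apply: le_trans (@premeasure_le_finite _ s delta c (P m) _ U s0 _ _ _) _.
- by rewrite c0.
- move=> lambda [d [Od dm ->]].
  exists [tuple of mkseq (fun k => d k == 2%N) n] => //; exists d; split=> // k kn.
  by rewrite /= nth_mkseq//; case: (Od k) => ->.
- move=> t _ _ [d [Od dm -> dt]] [e' [Oe em -> et]].
  have m0 : 0 < 3 ^- m :> R by rewrite invr_gt0 exprn_gt0.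
  have d0' := lt_le_trans m0 dm; have e0' := lt_le_trans m0 em.
  rewrite Lambda_dist// normrM distrC gtr0_norm; last by rewrite divr_gt0 ?mulr_gt0.
  apply: ler_pM => //.
  + by rewrite divr_ge0// ltW// mulr_gt0.
  + rewrite ler_pM2l ?mulr_gt0// -[leRHS]invrK lef_pV2 ?posrE;
      rewrite ?invr_gt0 ?exprn_gt0 ?mulr_gt0//.
    rewrite (_ : 9 = 3 * 3) ?exprMn ?invfM; last by rewrite -natrM.
    by apply: ler_pM => //; exact: ltW.
  + by apply: ternary_sum_cylinder => // k kn; rewrite dt// et.
by rewrite lee_fin card_tuple card_bool natrX.
Qed.

End UpperBound.

(** * Lower bound: from covers of [Lambda_not x] to covers by cylinders of free bits *)

Section LowerBound.
Context {R : realType}.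
Implicit Types (x s : R) (p : nat) (g omega : nat -> bool).

Lemma ternary_sum_code_gt0 p g omega : g 0%N ->
  0 < ternary_sum (sparse_code p g omega) :> R.
Proof.
move=> g0; rewrite ternary_sumS; last exact: Omega_sparse_code.
rewrite divr_gt0// ltr_wpDr ?ternary_sum_ge0//.
  exact/Omega_shift/Omega_sparse_code.
by rewrite /sparse_code mod0n div0n g0 ltr0n.
Qed.

Lemma geometric_bracket (B r : R) : 1 < B -> 0 < r < 1 ->
  exists q : nat, B ^- q.+1 <= r < B ^- q.
Proof.
move=> B1 /andP[r0 r1]; have B0 := lt_trans ltr01 B1.
have Bi1 : `|B^-1| < 1 by rewrite gtr0_norm ?invr_gt0// invf_lt1.
have exq : exists q, B ^- q <= r.
  have [q _ /(_ q (leqnn _))] := cvgr0_norm_lt _ (cvg_geometric 1 Bi1) _ r0.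
  rewrite /= mul1r exprVn gtr0_norm ?invr_gt0 ?exprn_gt0// => /ltW.
  by exists q.
case: (ex_minnP exq) => -[|q] Bq qmin.
  by move: Bq; rewrite expr0 invr1 leNgt r1.
by exists q; rewrite Bq ltNge; apply/negP => /qmin; rewrite ltnn.
Qed.

(** Ternary sums are at most 1, so t |-> 2x / t expands distances by at least 2x. Two sums with
    images in [U] are thus within c / (2x), hence share q blocks of digits, that is q p free
    bits. *)
Lemma code_cylinder x p g q (c : R) omega0 omega (U : set R) :
  0 < x -> (0 < p)%N -> g 0%N -> (forall y z, U y -> U z -> `|y - z| <= c) ->
  c / (2 * x) < 3 ^- (q * p.+1) ->
  U (2 * x / ternary_sum (sparse_code p g omega0)) ->
  U (2 * x / ternary_sum (sparse_code p g omega)) ->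
  mkseq omega (q * p) = mkseq omega0 (q * p).
Proof.
move=> x0 p0 g0 Uc cq U0 U1.
have T0 := ternary_sum_code_gt0 p omega0 g0; have T1 := ternary_sum_code_gt0 p omega g0.
have := Uc _ _ U0 U1; rewrite Lambda_dist// => cd.
apply: (@eq_from_nth _ false); rewrite !size_mkseq// => j jq; rewrite !nth_mkseq//.
 apply: (@code_agree p g _ _ q) => // k.
apply: (@ternary_sum_gap R); [exact: Omega_sparse_code..|].
apply: le_lt_trans cq; rewrite ler_pdivlMr ?mulr_gt0// mulrC.
apply: le_trans cd; rewrite normrM ler_wpM2r// gtr0_norm ?divr_gt0 ?mulr_gt0//.
rewrite ler_pdivlMr ?mulr_gt0// ler_piMr//; first by rewrite ltW// mulr_gt0.
by apply: mulr_ile1; [exact: ltW|exact: ltW|..]; apply: ternary_sum_le1;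
  exact: Omega_sparse_code.
Qed.

(** One cylinder of free bits captures all codes landing in [U], with mass controlled by |U|^s. The
    slack [eta] pays for sets of diameter 0 and for sets that meet no code. *)
Lemma code_cover_word x s p g (U : set R) (eta : R) :
  0 < x -> 0 <= s -> (0 < p)%N -> (3 ^+ p.+1) `^ s <= 2 ^+ p -> g 0%N ->
  0 < eta -> (diam U <= x%:E)%E ->
  exists u : seq bool,
    ((2 ^- size u)%:E <=
       ((3 ^+ p.+1 / (2 * x)) `^ s)%:E * diam_pow s U + eta%:E)%E /\
    forall omega, U (2 * x / ternary_sum (sparse_code p g omega)) ->
      mkseq omega (size u) = u.
Proof.
move=> x0 s0 p0 hp g0 eta0 dU; set C := (_ `^ s).
have C0 : 0 <= C by exact: powR_ge0.
have [n _ /(_ n (leqnn _))] := near_infty_natSinv_expn_lt (PosNum eta0).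
rewrite /= div1r => /ltW n_eta.
have le_eta (r : R) : r <= eta -> (r%:E <= C%:E * diam_pow s U + eta%:E)%E.
  move=> r_eta; rewrite (@le_trans _ _ eta%:E) ?lee_fin// leeDr//.
  by rewrite mule_ge0 ?diam_pow_ge0// lee_fin.
have [[omega0 U0]|noU] := pselect (exists omega,
  U (2 * x / ternary_sum (sparse_code p g omega)));
  last first.
  exists (nseq n false); split; first by rewrite size_nseq le_eta.
  by move=> omega Uo; case: noU; exists omega.
have diam0 : (0 <= diam U)%E by have := diam_ge U0 U0; rewrite subrr normr0.
have dfin : diam U \is a fin_num by rewrite ge0_fin_numE// (le_lt_trans dU)// ltry.
pose c := fine (diam U); have cE : diam U = c%:E by rewrite fineK.
have c_ge0 : 0 <= c by rewrite fine_ge0.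
have Uc y z : U y -> U z -> `|y - z| <= c.
  by move=> Uy Uz; rewrite -lee_fin -cE diam_ge.
have dpE : diam_pow s U = (c `^ s)%:E.
  by rewrite /diam_pow asboolF ?cE//; move=> UE; rewrite UE in U0.
pose w q := mkseq omega0 (q * p).
suff [q cq wq] : exists2 q : nat, c / (2 * x) < 3 ^- (q * p.+1) &
    2 ^- (q * p) <= C * c `^ s + eta.
  exists (w q); rewrite size_mkseq dpE; split=> [|omega Uo].
    by rewrite -EFinM -EFinD lee_fin.
  exact: code_cylinder Uc cq U0 Uo.
have [c0|c_neq0] := eqVneq c 0.
  exists n; first by rewrite c0 mul0r invr_gt0 exprn_gt0.
  apply: le_trans (_ : eta <= _); last by rewrite lerDr mulr_ge0// powR_ge0.
  apply: le_trans n_eta; rewrite lef_pV2 ?posrE ?exprn_gt0//.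
  by rewrite ler_weXn2l ?ler1n// leq_pmulr.
have c_gt0 : 0 < c by rewrite lt0r c_neq0.
(* The diameter is at most x, so this ratio is in fact at most 1/2. *)
have r01 : 0 < c / (2 * x) < 1.
  rewrite divr_gt0 ?mulr_gt0// ltr_pdivrMr ?mulr_gt0// mul1r.
  by move: dU; rewrite cE lee_fin => cx; lra.
have B1 : 1 < 3 ^+ p.+1 :> R by rewrite exprn_egt1// ltr1n.
have B0 := lt_trans ltr01 B1.
have [q /andP[Bq1 Bq]] := geometric_bracket B1 r01.
exists q; first by rewrite mulnC exprM.
apply: le_trans (_ : C * c `^ s <= _); last by rewrite lerDl ltW.
rewrite mulnC exprM.
(* With B = 3^(p+1), the chain is 2^-(pq) <= (B^-q)^s <= (B c / (2x))^s = C c^s, by [hp] and then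
   [Bq1]. *)
apply: (@le_trans _ _ (((3 ^+ p.+1) `^ s) ^- q)).
  rewrite lef_pV2 ?posrE ?exprn_gt0 ?powR_gt0//.
  by rewrite lerXn2r ?nnegrE ?powR_ge0 ?exprn_ge0.
have Bx0 : 0 < 3 ^+ p.+1 / (2 * x) by rewrite divr_gt0 ?mulr_gt0.
rewrite -(powR_exprV _ _ (ltW B0)) /C -(powRM _ (ltW Bx0) c_ge0).
apply: ge0_ler_powR => //.
- by rewrite nnegrE invr_ge0 exprn_ge0// ltW.
- by rewrite nnegrE mulr_ge0// ltW.
rewrite mulrAC -mulrA -ler_pdivrMl//; apply: le_trans Bq1.
by rewrite -invfM -exprS.
Qed.

(** In logarithms this reads (p + 1) s ln 3 <= p ln 2, which holds for large p because s ln 3 < ln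
    2. *)
Lemma block_size s : s < ln 2 / ln 3 ->
  exists2 p : nat, (0 < p)%N & (3 ^+ p.+1) `^ s <= 2 ^+ p :> R.
Proof.
rewrite ltr_pdivlMr ?ln3_gt0// -subr_gt0 => gap0.
have [p hp] : exists p : nat, s * ln 3 / (ln 2 - s * ln 3) <= p.+1%:R.
  set r := _ / _; exists (Num.bound `|r|).
  rewrite (le_trans (ler_norm _))// ltW// (lt_trans (archi_boundP (normr_ge0 _)))//.
  by rewrite ltr_nat.
exists p.+1 => //; rewrite -ler_ln ?posrE ?powR_gt0 ?exprn_gt0//.
rewrite ln_powR !lnXn//; move: hp; rewrite ler_pdivrMr//.
rewrite -[ln 3 *+ _]mulr_natl -[ln 2 *+ _]mulr_natl -natr1; lra.
Qed.

Lemma Lambda_not_code x p omega : 0 < x ->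
  exists2 g : nat -> bool, g = xpredT \/ g = dyadic_alternating &
    Lambda_not x (2 * x / ternary_sum (sparse_code p g omega)).
Proof.
move=> x0.
have inL g : g 0%N -> ~ cvgn (digit_freq 2 (sparse_code p g omega) : nat -> R) ->
    Lambda_not x (2 * x / ternary_sum (sparse_code p g omega)).
  move=> g0 ncvg; have T0 := ternary_sum_code_gt0 p omega g0.
  split; first by apply/LambdaP => //; exists (sparse_code p g omega); split => //;
    exact: Omega_sparse_code.
  move=> i i02; rewrite Phi_ternary_sum//; last exact: Omega_sparse_code.
  by move=> /(cvg_digit_freq2 (@Omega_sparse_code p g omega) i02).
have [cA|] := pselect (cvgn (digit_freq 2 (sparse_code p xpredT omega) : nat -> R)).
  exists dyadic_alternating; first by right.
  by apply: inL; [|exact: digit_freq_dichotomy cA].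
by exists xpredT; [left|exact: inL].
Qed.

Lemma hausdorff_measure_Lambda_not x s : 0 < x -> 0 <= s -> s < ln 2 / ln 3 ->
  hausdorff_measure s (Lambda_not x) <> 0%E.
Proof.
move=> x0 s0 s23 /hausdorff_measure_eq0/(_ x x0) H0.
have [p p0 hp] := block_size s23.
pose C := (3 ^+ p.+1 / (2 * x)) `^ s.
have C0 : 0 < C by rewrite powR_gt0// divr_gt0 ?mulr_gt0 ?exprn_gt0.
(* Each [U k] gives two words, so the total mass is less than 2C / (8C) plus the sum 1/2 of the
   [eta k], that is 3/4. *)
have : (hausdorff_premeasure s x (Lambda_not x) < (8 * C)^-1%:E)%E.
  by rewrite H0 lte_fin invr_gt0 mulr_gt0.
move=> /ereal_inf_lt[_ [U [LU dU] <-] sumU].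
pose eta k : R := 2^-1 / (2 ^ k.+1)%:R.
have eta0 k : 0 < eta k by rewrite divr_gt0// ltr0n expn_gt0.
have word g : g 0%N -> {u : nat -> seq bool & forall k,
    ((2 ^- size (u k))%:E <= C%:E * diam_pow s (U k) + (eta k / 2)%:E)%E /\
    forall omega, U k (2 * x / ternary_sum (sparse_code p g omega)) ->
      mkseq omega (size (u k)) = u k}.
  move=> g0; apply: (@choice _ _ (fun k u =>
    ((2 ^- size u)%:E <= C%:E * diam_pow s (U k) + (eta k / 2)%:E)%E /\
    forall omega, U k (2 * x / ternary_sum (sparse_code p g omega)) ->
      mkseq omega (size u) = u)) => k.
  by apply: code_cover_word => //; rewrite divr_gt0.
have [uA /all_and2[massA cylA]] := word xpredT isT.
have [uB /all_and2[massB cylB]] := word dyadic_alternating isT.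
(* One of the two codes of the avoiding [omega] lies in [Lambda_not x], hence in some [U k], which
   forces [uA k] or [uB k] to be a prefix of [omega]. *)
have [|omega avoid] := @cylinder_cover R (fun k => [:: uA k; uB k]); last first.
  have [g gAB /LU[k _ Ug]] := Lambda_not_code p omega x0.
  case: gAB Ug => -> Ug.
    by apply: (avoid k (uA k)); [rewrite mem_head|exact: cylA].
  by apply: (avoid k (uB k)); [rewrite !inE eqxx orbT|exact: cylB].
apply: (@le_lt_trans _ _
  (\sum_(0 <= k <oo) ((2 * C)%:E * diam_pow s (U k) + (eta k)%:E))%E).
  apply: lee_nneseries => k _.
    by move=> _; rewrite lee_fin sumr_ge0// => u _; rewrite invr_ge0 exprn_ge0.
  rewrite big_cons big_seq1 EFinD (le_trans (leeD (massA k) (massB k)))//.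
  rewrite addeACA -EFinD -splitr leeD2r// mulr_natl mulr2n EFinD ge0_muleDl//.
    by rewrite lee_fin ltW.
  by rewrite lee_fin ltW.
apply: le_lt_trans (epsilon_trick _ _ _) _ => //.
  by move=> k; rewrite mule_ge0 ?diam_pow_ge0// lee_fin mulr_ge0// ltW.
rewrite nneseriesZl; last by move=> k _; exact: diam_pow_ge0.
apply: (@lt_le_trans _ _ ((2 * C)%:E * ((8 * C)^-1)%:E + (2^-1)%:E)%E).
  by rewrite lte_leD// lte_pmul2l// lte_fin mulr_gt0.
rewrite -EFinM -EFinD lee_fin invfM mulrACA divff ?lt0r_neq0// mulr1; lra.
Qed.

End LowerBound.

Unset Implicit Arguments.

Theorem theorem1p3 (R : realType) (x : R) (hx : 0 < x) :
  hausdorff_dim (Lambda_not x) = (ln 2 / ln 3)%:E.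
Proof.
apply/le_anti/andP; split.
  apply/lee_addgt0Pr => e e0; rewrite -EFinD; apply: ereal_inf_lbound.
  have s23 : ln 2 / ln 3 < ln 2 / ln 3 + e :> R by rewrite ltrDl.
  exists (ln 2 / ln 3 + e) => //; split.
    by rewrite addr_ge0// ?ltW// divr_gt0// ln_gt0// ltr1n.
  by apply: hausdorff_measure_Lambda hx s23 _ => lambda [].
apply: le_ereal_inf_tmp => _ [s [s0 Hs] <-]; rewrite lee_fin leNgt.
by apply/negP => s23; exact: hausdorff_measure_Lambda_not hx s0 s23 Hs.
Qed.
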